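(* Let $n>2$ be even and let $\mathcal F=\{F_1,\dots,F_k\}$ be a $k$-MOFS$(n)$ in which every frequency square has the property that every pair of its rows is either equal or complementary. Then $\mathcal F$ has at least $(n/2)^4$ basic trades each of which, when switched, produces a set of MOFS that is not isomorphic to $\mathcal F$.
   Context: Let $N(n)=\{1,\dots,n\}$ and let $n$ be even. A (binary) frequency square of order $n$ is an $n\times n$ array indexed by $N(n)\times N(n)$ with entries in $\{0,1\}$ such that every row and every column contains exactly $n/2$ zeros and $n/2$ ones. Two frequency squares $F,G$ of order $n$ are orthogonal if for each $(a,b)\in\{0,1\}^2$ the number of cells $(r,c)$ with $(F[r,c],G[r,c])=(a,b)$ equals $n^2/4$. A $k$-MOFS$(n)$ is an ordered set $F_1,\dots,F_k$ of pairwise orthogonal frequency squares of order $n$. Two rows are complementary if one is obtained from the other by replacing each entry $e$ by $1-e$. A tuple $(C_1,\dots,C_k)$ of subsets of $N(n)\times N(n)$, not all empty, is switched by replacing $F_i[x,y]$ with $1-F_i[x,y]$ for every $(x,y)\in C_i$, for each $i$; it is a trade if the result of switching is again a $k$-MOFS$(n)$. For nonempty $C\subseteq N(n)\times N(n)$ define $C_i=C$ if $F_i$ agrees with $F_1$ on every cell of $C$ or disagrees with $F_1$ on every cell of $C$, and $C_i=\emptyset$ otherwise; if $(C_1,\dots,C_k)$ is a trade, it is called a basic trade. Two sets of MOFS are isomorphic if one can be obtained from the other by a sequence of: applying the same permutation to the rows of all squares; applying the same permutation to the columns of all squares; transposing all squares; interchanging $0$ and $1$ in one square; permuting the order of the squares.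 *)

(* Defs.v *)
From mathcomp Require Import all_boot all_fingroup all_algebra.

Set Implicit Arguments.
Unset Strict Implicit.
Unset Printing Implicit Defensive.

(* Squares are Boolean matrices, false being the symbol 0 and true the       *)
(* symbol 1; rows and columns are numbered from 0.                            *)

Definition freq_square n (F : 'M[bool]_n) : bool :=
  [forall r : 'I_n, forall a : bool, #|[set c : 'I_n | F r c == a]| == n %/ 2]
  && [forall c : 'I_n, forall a : bool,
        #|[set r : 'I_n | F r c == a]| == n %/ 2].

Definition orthogonal_squares n (F G : 'M[bool]_n) : bool :=
  [forall a : bool, forall b : bool,
     #|[set p : 'I_n * 'I_n | (F p.1 p.2 == a) && (G p.1 p.2 == b)]|
       == n ^ 2 %/ 4].

Definition is_mofs n k (F : {ffun 'I_k -> 'M[bool]_n}) : bool :=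
  [forall i : 'I_k, freq_square (F i)]
  && [forall i : 'I_k, forall j : 'I_k,
        (i != j) ==> orthogonal_squares (F i) (F j)].

Definition complementary n (u v : 'rV[bool]_n) : bool := v == map_mx negb u.

Definition switch n k (F : {ffun 'I_k -> 'M[bool]_n})
    (T : {ffun 'I_k -> {set 'I_n * 'I_n}}) : {ffun 'I_k -> 'M[bool]_n} :=
  [ffun i => (\matrix_(x < n, y < n)
     (if (x, y) \in T i then ~~ F i x y else F i x y))%R].

Definition is_trade n k (F : {ffun 'I_k -> 'M[bool]_n})
    (T : {ffun 'I_k -> {set 'I_n * 'I_n}}) : bool :=
  [exists i : 'I_k, T i != set0] && is_mofs (switch F T).

(* The first square of the family, F ord0, is the reference square; hence     *)
(* the number of squares is written k.+1.                                     *)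
Definition basic_tuple n k (F : {ffun 'I_k.+1 -> 'M[bool]_n})
    (C : {set 'I_n * 'I_n}) : {ffun 'I_k.+1 -> {set 'I_n * 'I_n}} :=
  [ffun i => if [forall p in C, F i p.1 p.2 == F ord0 p.1 p.2]
                || [forall p in C, F i p.1 p.2 != F ord0 p.1 p.2]
             then C else set0].

Definition is_basic_trade n k (F : {ffun 'I_k.+1 -> 'M[bool]_n})
    (T : {ffun 'I_k.+1 -> {set 'I_n * 'I_n}}) : bool :=
  [exists C : {set 'I_n * 'I_n}, (C != set0) && (T == basic_tuple F C)]
  && is_trade F T.

Definition iso_step n k : rel {ffun 'I_k -> 'M[bool]_n} := fun F G =>
  [|| [exists s : 'S_n, G == [ffun i => row_perm s (F i)]],
      [exists s : 'S_n, G == [ffun i => col_perm s (F i)]],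
      G == [ffun i => trmx (F i)],
      [exists j : 'I_k,
         G == [ffun i => if i == j then map_mx negb (F i) else F i]]
    | [exists s : 'S_k, G == [ffun i => F (s i)]]].

Definition isomorphic n k : rel {ffun 'I_k -> 'M[bool]_n} :=
  connect (@iso_step n k).

(* Main.v *)
Require Import Defs.
From mathcomp Require Import all_boot all_fingroup all_algebra.

(** The hypothesis says that each square has the form F_i[x,y] = a_i(x) + b_i(y)
    modulo 2, i.e. that every 2 x 2 subarray has even sum.  Choose rows r, s on
    which a_1 differs and columns c, d on which b_1 differs, and let C be
    {r,s} x {c,d}; there are (n/2)^4 such C.  The squares switched by C are those
    for which both a_i and b_i differ, and for them switching C amounts to
    exchanging either the rows or the columns inside C.  A square that is not
    switched is fixed by one of these two exchanges, so any two squares of the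
    switched family are obtained from the old ones by a common permutation of
    the cells, which preserves orthogonality.  Evenness of all 2 x 2 subarrays
    is an isomorphism invariant, and for n > 2 the switched first square violates
    it on a subarray meeting C in a single cell. *)

Set Implicit Arguments.
Unset Strict Implicit.
Unset Printing Implicit Defensive.

(** * Even 2 x 2 subarrays and their invariance under isomorphism *)

Definition even_minors n (M : 'M[bool]_n) : Prop :=
  forall r s c d, M r c (+) M r d = M s c (+) M s d.

Lemma even_minors_rows n (M : 'M[bool]_n) :
  (forall r s, row r M = row s M \/ complementary (row r M) (row s M)) ->
  even_minors M.
Proof.
move=> H r s c d; case: (H r s) => [/rowP E | /eqP/rowP E].
  by move: (E c) (E d); rewrite !mxE => -> ->.
by move: (E c) (E d); rewrite !mxE => -> ->; rewrite addNb addbN negbK.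
Qed.

Lemma iso_step_even_minors n k (F G : {ffun 'I_k -> 'M[bool]_n}) :
  iso_step F G -> (forall i, even_minors (F i)) -> forall i, even_minors (G i).
Proof.
move=> st H i r s c d; case/or4P: st => [/existsP[t /eqP->]|/existsP[t /eqP->]|
  /eqP->|/orP[/existsP[j /eqP->]|/existsP[t /eqP->]]]; rewrite !ffunE.
- by rewrite !mxE; exact: H.
- by rewrite !mxE; exact: H.
- rewrite !mxE; have := H i c d r s.
  by case: (F i c r); case: (F i c s); case: (F i d r); case: (F i d s).
- case: eqP => _; last exact: H.
  rewrite !mxE; have := H i r s c d.
  by case: (F i r c); case: (F i r d); case: (F i s c); case: (F i s d).
- exact: H.
Qed.

Lemma isomorphic_even_minors n k (F G : {ffun 'I_k -> 'M[bool]_n}) :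
  isomorphic F G -> (forall i, even_minors (F i)) ->
  forall i, even_minors (G i).
Proof.
case/connectP=> p; elim: p F => [|E p IHp] F /= => [_ -> //|/andP[st pth] lst H].
by apply: IHp lst _ => //; exact: iso_step_even_minors st H.
Qed.

Lemma basic_tuple_ord0 n k (F : {ffun 'I_k.+1 -> 'M[bool]_n})
    (C : {set 'I_n * 'I_n}) :
  basic_tuple F C ord0 = C.
Proof.
rewrite ffunE ifT //; apply/orP; left.
by apply/forallP => p; apply/implyP.
Qed.

(** * Switching a rectangle in one square or in two *)

Section Rectangle.

Variables (n : nat) (r s c d : 'I_n).

Definition rectangle : {set 'I_n * 'I_n} := setX [set r; s] [set c; d].

Definition row_swap (p : 'I_n * 'I_n) :=
  if p.2 \in [set c; d] then (tperm r s p.1, p.2) else p.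

Definition col_swap (p : 'I_n * 'I_n) :=
  if p.1 \in [set r; s] then (p.1, tperm c d p.2) else p.

Lemma row_swap_inj : injective row_swap.
Proof.
apply: (can_inj (g := row_swap)) => -[x y]; rewrite /row_swap /=.
by have [yC|/negPf yC] := boolP (y \in [set c; d]); rewrite /= yC ?tpermK.
Qed.

Lemma col_swap_inj : injective col_swap.
Proof.
apply: (can_inj (g := col_swap)) => -[x y]; rewrite /col_swap /=.
by have [xC|/negPf xC] := boolP (x \in [set r; s]); rewrite /= xC ?tpermK.
Qed.

(** If M[x,y] = a(x) + b(y) modulo 2, the two factors say that a differs on [r], [s] and b differs
    on [c], [d]. *)
Definition switchable (M : 'M[bool]_n) :=
  (M r c (+) M s c) && (M r c (+) M r d).

(** The sum modulo 2 matches [row_swapE] or [col_swapE] as soon as [switchable M] equals the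
    corresponding one of its factors. *)
Definition switched (M : 'M[bool]_n) (p : 'I_n * 'I_n) :=
  M p.1 p.2 (+) ((p \in rectangle) && switchable M).

Section Square.

Variable M : 'M[bool]_n.
Hypothesis evM : even_minors M.

(** Exchanging [r] and [s] changes their entries in column y by [M r y (+) M s y], which by evenness
    does not depend on y. *)
Lemma row_swapE p :
  M (row_swap p).1 (row_swap p).2 =
    M p.1 p.2 (+) ((p \in rectangle) && (M r c (+) M s c)).
Proof.
case: p => x y; rewrite /row_swap /rectangle in_setX /=.
case: ifP => /= yC; last by rewrite andbF addbF.
have := evM r s c y; rewrite !inE.
case: tpermP => [->|->|/eqP/negPf-> /eqP/negPf->]; rewrite ?eqxx ?orbT /= ?addbF //.
  by case: (M r c); case: (M s c); case: (M r y); case: (M s y).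
by case: (M r c); case: (M s c); case: (M r y); case: (M s y).
Qed.

Lemma col_swapE p :
  M (col_swap p).1 (col_swap p).2 =
    M p.1 p.2 (+) ((p \in rectangle) && (M r c (+) M r d)).
Proof.
case: p => x y; rewrite /col_swap /rectangle in_setX /=.
case: ifP => /= xC; last by rewrite addbF.
have := evM r x c d; rewrite !inE.
case: tpermP => [->|->|/eqP/negPf-> /eqP/negPf->]; rewrite ?eqxx ?orbT /= ?addbF //.
  by case: (M r c); case: (M r d); case: (M x c); case: (M x d).
by case: (M r c); case: (M r d); case: (M x c); case: (M x d).
Qed.

(** In every row of a switchable square the entries in columns [c] and [d] differ, so flipping both
    of them merely transposes them. *)
Lemma card_switched_row x (a : bool) :
  #|[set y | switched M (x, y) == a]| = #|[set y | M x y == a]|.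
Proof.
have [sw|nsw] := boolP (switchable M); last first.
  by apply: eq_card => y; rewrite !inE /switched (negPf nsw) andbF addbF.
pose t : 'S_n := if x \in [set r; s] then tperm c d else 1%g.
rewrite -[RHS](card_preimset _ (@perm_inj _ t)); apply: eq_card => y.
rewrite !inE /switched sw -[RHS]/(M x (t y) == a); congr (_ == a).
case/andP: sw => _ bM; rewrite -[true]bM -col_swapE /col_swap /t /=.
by case: ifP; rewrite ?perm1.
Qed.

Lemma card_switched_col y (a : bool) :
  #|[set x | switched M (x, y) == a]| = #|[set x | M x y == a]|.
Proof.
have [sw|nsw] := boolP (switchable M); last first.
  by apply: eq_card => x; rewrite !inE /switched (negPf nsw) andbF addbF.
pose t : 'S_n := if y \in [set c; d] then tperm r s else 1%g.
rewrite -[RHS](card_preimset _ (@perm_inj _ t)); apply: eq_card => x.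
rewrite !inE /switched sw -[RHS]/(M (t x) y == a); congr (_ == a).
case/andP: sw => aM _; rewrite -[true]aM -row_swapE /row_swap /t /=.
by case: ifP; rewrite ?perm1.
Qed.

End Square.

Lemma switched_common_permutation (M N : 'M[bool]_n) :
  even_minors M -> even_minors N ->
  exists2 f : 'I_n * 'I_n -> 'I_n * 'I_n, injective f
    & forall p, switched M p = M (f p).1 (f p).2
             /\ switched N p = N (f p).1 (f p).2.
Proof.
move=> evM evN.
have [|nsw] := boolP (~~ switchable M && ~~ switchable N).
  case/andP=> /negPf nM /negPf nN; exists id; first by [].
  by move=> p; rewrite /switched nM nN andbF !addbF.
have [arow|ncol] := boolP
  ((switchable M == M r c (+) M s c) && (switchable N == N r c (+) N s c)).
  exists row_swap; first exact: row_swap_inj.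
  by case/andP: arow => /eqP aM /eqP aN p; rewrite /switched aM aN !row_swapE.
(* The row exchange fails only when one square differs on the rows but not on the columns. The other
   square is then switchable, and the column exchange serves both. *)
exists col_swap; first exact: col_swap_inj.
suff [aM aN] : switchable M = M r c (+) M r d /\ switchable N = N r c (+) N r d.
  by move=> p; rewrite /switched aM aN !col_swapE.
move: nsw ncol; rewrite /switchable.
case: (M r c (+) M s c); case: (M r c (+) M r d);
  by case: (N r c (+) N s c); case: (N r c (+) N r d).
Qed.

(** * Switching a rectangle throughout the family *)

Section Family.

Variables (k : nat) (F : {ffun 'I_k.+1 -> 'M[bool]_n}).
Hypothesis evF : forall i, even_minors (F i).
Hypothesis swF : switchable (F ord0).

(** Two squares agree everywhere or disagree everywhere on the rectangle exactly when they have the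
    same row difference and the same column difference there; for [F ord0] both differences are
    1. *)
Lemma basic_tuple_rectangle i :
  basic_tuple F rectangle i = if switchable (F i) then rectangle else set0.
Proof.
rewrite ffunE; congr (if _ then _ else _).
have := swF; have := evF ord0 r s c d; have := evF i r s c d.
rewrite /switchable => evi ev0 sw0; apply/idP/idP.
  by case/orP=> /forallP H;
    have := H (r, c); have := H (s, c); have := H (r, d);
    rewrite !inE !eqxx ?orbT /=; move: sw0;
    case: (F i r c); case: (F i s c); case: (F i r d);
    case: (F ord0 r c); case: (F ord0 s c); case: (F ord0 r d).
(* The corner (r, c) decides between agreement and disagreement. *)
move=> swi; case: (boolP (F i r c == F ord0 r c)) => e; apply/orP; [left|right];
  apply/forallP => -[x y]; apply/implyP; rewrite !inE /=;
  case/andP => /orP[]/eqP-> /orP[]/eqP->; move: e swi sw0 evi ev0;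
  by case: (F i r c); case: (F i s c); case: (F i r d); case: (F i s d);
     case: (F ord0 r c); case: (F ord0 s c); case: (F ord0 r d);
     case: (F ord0 s d).
Qed.

Lemma switch_rectangle i x y :
  switch F (basic_tuple F rectangle) i x y = switched (F i) (x, y).
Proof.
rewrite ffunE mxE basic_tuple_rectangle /switched.
by case: (switchable (F i)); rewrite ?inE ?andbT ?andbF ?addbF //;
  case: ifP => _; rewrite ?addbT ?addbF.
Qed.

Lemma switch_rectangle_mofs :
  is_mofs F -> is_mofs (switch F (basic_tuple F rectangle)).
Proof.
case/andP=> /forallP fF /forallP oF; apply/andP; split.
  apply/forallP => i; case/andP: (fF i) => /forallP fr /forallP fc.
  apply/andP; split; apply/forallP => x; apply/forallP => a.
    rewrite -(eqP (forallP (fr x) a)) -(card_switched_row (evF i)).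
    by apply/eqP/eq_card => y; rewrite !inE switch_rectangle.
  rewrite -(eqP (forallP (fc x) a)) -(card_switched_col (evF i)).
  by apply/eqP/eq_card => y; rewrite !inE switch_rectangle.
apply/forallP => i; apply/forallP => j; apply/implyP => ij.
have /forallP oij := implyP (forallP (oF i) j) ij.
apply/forallP => a; apply/forallP => b; rewrite -(eqP (forallP (oij a) b)).
have [f f_inj fE] := switched_common_permutation (evF i) (evF j).
rewrite -[X in _ == X](card_preimset _ f_inj); apply/eqP/eq_card => -[x y].
by rewrite !inE !switch_rectangle /=; case: (fE (x, y)) => -> ->.
Qed.

Lemma basic_trade_rectangle :
  is_mofs F -> is_basic_trade F (basic_tuple F rectangle).
Proof.
move=> mF; have ne : rectangle != set0.
  by apply/set0Pn; exists (r, c); rewrite !inE !eqxx.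
apply/andP; split; first by apply/existsP; exists rectangle; rewrite ne /=.
rewrite /is_trade switch_rectangle_mofs // andbT.
by apply/existsP; exists ord0; rewrite basic_tuple_ord0.
Qed.

Lemma switch_rectangle_not_isomorphic :
  2 < n -> ~~ isomorphic F (switch F (basic_tuple F rectangle)).
Proof.
move=> n_gt2; have outside (u v : 'I_n) : exists w, w \notin [set u; v].
  have: [set u; v] != setT.
    apply: contraTneq n_gt2 => uvT.
    by rewrite -[n]card_ord -cardsT -uvT cards2 -leqNgt; case: (_ != _).
  by rewrite -subTset => /subsetPn[w _ wuv]; exists w.
have [x xrs] := outside r s; have [y ycd] := outside c d.
apply/negP => /isomorphic_even_minors/(_ evF ord0 r x c y).
rewrite !switch_rectangle /switched swF !in_setX (negPf xrs) (negPf ycd).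
rewrite !inE !eqxx /= !addbF; have := evF ord0 r x c y.
by case: (F ord0 r c); case: (F ord0 r y); case: (F ord0 x c);
  case: (F ord0 x y).
Qed.

End Family.

End Rectangle.

Theorem theorem4p3 (n k : nat) (F : {ffun 'I_k.+1 -> 'M[bool]_n}) :
  2 < n -> ~~ odd n -> is_mofs F ->
  (forall (i : 'I_k.+1) (r s : 'I_n),
     row r (F i) = row s (F i) \/ complementary (row r (F i)) (row s (F i))) ->
  (n %/ 2) ^ 4 <=
    #|[set T : {ffun 'I_k.+1 -> {set 'I_n * 'I_n}}
         | is_basic_trade F T && ~~ isomorphic F (switch F T)]|.
Proof.
move=> n_gt2 _ mF rowsF.
have evF i : even_minors (F i) by exact: even_minors_rows (rowsF i).
pose o : 'I_n := Ordinal (ltnW (ltnW n_gt2)).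
(* Column [o] and row [o] serve to read off a_1 and b_1 up to constants; each of their level sets
   has n/2 elements. *)
pose R a := [set x | F ord0 x o == a]; pose C a := [set y | F ord0 o y == a].
have [/forallP cardC /forallP cardR] := andP (forallP (andP mF).1 ord0).
(* Taking [r], [c] where the value is 0 and [s], [d] where it is 1 fixes the order in each pair, so
   each rectangle is counted once. *)
pose Q := setX (setX (R false) (R true)) (setX (C false) (C true)).
pose T (q : ('I_n * 'I_n) * ('I_n * 'I_n)) :=
  basic_tuple F (rectangle q.1.1 q.1.2 q.2.1 q.2.2).
have <- : #|Q| = (n %/ 2) ^ 4.
  rewrite !cardsX !(eqP (forallP (cardR o) _)) !(eqP (forallP (cardC o) _)).
  by rewrite !mulnn -expnM.
have T_inj : {in Q &, injective T}.
  move=> [[r s] [c d]] [[r' s'] [c' d']]; rewrite !inE /= => hq hq' /ffunP/(_ ord0).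
  rewrite !basic_tuple_ord0 => /setP E.
  have := E (r, c); have := E (s, d); rewrite !inE !eqxx ?orbT /=.
  case/andP: hq => /andP[/eqP hr /eqP hs] /andP[/eqP hc /eqP hd].
  case/andP: hq' => /andP[/eqP hr' /eqP hs'] /andP[/eqP hc' /eqP hd'].
  (* Rows, or columns, from opposite level sets are distinct, so membership of (r, c) and (s, d) in
     the second rectangle forces each index to equal its namesake. *)
  have neR x y : F ord0 x o != F ord0 y o -> (x == y) = false.
    by apply: contraNF => /eqP->.
  have neC x y : F ord0 o x != F ord0 o y -> (x == y) = false.
    by apply: contraNF => /eqP->.
  rewrite (neR r s') ?(neR s r') ?(neC c d') ?(neC d c') ?hr ?hs ?hc ?hd
    ?hr' ?hs' ?hc' ?hd' //= !orbF.
  by move=> /esym/andP[/eqP-> /eqP->] /esym/andP[/eqP-> /eqP->].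
rewrite -(card_in_imset T_inj); apply/subset_leq_card/subsetP => _ /imsetP[q qQ ->].
case: q qQ => [[r s] [c d]]; rewrite !inE /=.
case/andP=> /andP[/eqP hr /eqP hs] /andP[/eqP hc /eqP hd].
(* Evenness carries the differences seen along column [o] and row [o] over to the rectangle
   itself. *)
have sw : switchable r s c d (F ord0).
  have := evF ord0 r s c o; have := evF ord0 r o c d.
  rewrite /switchable hr hs hc hd.
  by case: (F ord0 r c); case: (F ord0 r d); case: (F ord0 s c).
by rewrite basic_trade_rectangle // switch_rectangle_not_isomorphic.
Qed.
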